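(* Let $\Gamma\subset\mathbb{R}^n$ ($n\ge2$) be a cone and let $f:\Gamma\to\mathbb{R}$ be a smooth symmetric function that is concave in $\Gamma$ and satisfies $$\lim_{t\to+\infty}f(t\lambda)>f(\mu)\quad\text{for all }\lambda,\mu\in\Gamma.$$ Let $\varrho$ be a real constant with $\varrho<\varrho_\Gamma$ and $\varrho\ne0$. Define $$\tilde\Gamma=\Big\{(\lambda_1,\dots,\lambda_n):\ \lambda_i=\tfrac1\varrho\Big(\sum_{j=1}^n\mu_j-(n-\varrho)\mu_i\Big),\ (\mu_1,\dots,\mu_n)\in\Gamma\Big\},$$ and define $\tilde f:\tilde\Gamma\to\mathbb{R}$ by $\tilde f(\lambda)=f(\mu)$, where $\mu_i=\frac{1}{n-\varrho}\left(\sum_{j=1}^n\lambda_j-\varrho\lambda_i\right)$. Then $\tilde f$ is uniformly elliptic in $\tilde\Gamma$: there exists a uniform constant $\theta>0$ such that $$\frac{\partial\tilde f}{\partial\lambda_i}(\lambda)\ge\theta\sum_{j=1}^n\frac{\partial\tilde f}{\partial\lambda_j}(\lambda)>0\quad\text{for all }\lambda\in\tilde\Gamma,\ 1\le i\le n.$$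
   Context: A ''cone'' $\Gamma\subset\mathbb{R}^n$ means an open, symmetric (invariant under permutations of coordinates), convex cone with vertex at the origin, $\partial\Gamma\ne\emptyset$, containing $\Gamma_n=\{\lambda\in\mathbb{R}^n:\lambda_i>0\ \forall i\}$. The constant $\varrho_\Gamma$ is defined by $(1,\dots,1,1-\varrho_\Gamma)\in\partial\Gamma$; one has $1\le\varrho_\Gamma\le n$, so $\varrho<n$ above. *)

(* Defs.v *)
From mathcomp Require Import all_boot all_order all_algebra all_fingroup.
From mathcomp Require Import all_classical all_reals all_analysis.

Set Implicit Arguments.
Unset Strict Implicit.
Unset Printing Implicit Defensive.

Import Order.TTheory GRing.Theory Num.Theory.
Import numFieldNormedType.Exports.

Local Open Scope classical_set_scope.
Local Open Scope ring_scope.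

Definition boundary (T : topologicalType) (A : set T) : set T :=
  closure A `\` interior A.

Definition positive_orthant (R : realType) (n : nat) : set 'rV[R]_n :=
  [set x | forall i, 0 < x 0 i].
Arguments positive_orthant {R n}.

Record is_cone (R : realType) (n : nat) (G : set 'rV[R]_n) : Prop := IsCone {
  cone_open : open G;
  cone_sym : forall (s : 'S_n) (x : 'rV[R]_n), G x -> G (col_perm s x);
  cone_convex : convex_set G;
  cone_scale : forall (t : R) (x : 'rV[R]_n), 0 < t -> G x -> G (t *: x);
  cone_boundary : boundary G !=set0;
  cone_orthant : positive_orthant `<=` G }.

(* (1, ..., 1, 1 - r) *)
Definition last_shift (R : realType) (n : nat) (r : R) : 'rV[R]_n :=
  \row_(i < n) (if i.+1 == n then 1 - r else 1).
Arguments last_shift {R} n r.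

(* Chosen by [get]: for a cone G (n >= 2) there is exactly one r such that
   (1, ..., 1, 1 - r) lies on the boundary of G. *)
Definition varrho (R : realType) (n : nat) (G : set 'rV[R]_n) : R :=
  get [set r : R | boundary G (last_shift n r)].

Definition partial (R : realType) (n : nat) (i : 'I_n) (f : 'rV[R]_n -> R) :
    'rV[R]_n -> R :=
  fun x => 'D_(delta_mx 0 i) f x.

(* C^oo on an open set A: every iterated partial derivative of f, f itself
   included, is Frechet differentiable at each point of A.  Values of f
   outside A are irrelevant. *)
Definition smooth_on (R : realType) (n : nat) (A : set 'rV[R]_n)
    (f : 'rV[R]_n -> R) : Prop :=
  forall (s : seq 'I_n) (x : 'rV[R]_n), A x ->
    differentiable (foldr (@partial R n) f s) x.

Definition symmetric_on (R : realType) (n : nat) (A : set 'rV[R]_n)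
    (f : 'rV[R]_n -> R) : Prop :=
  forall (s : 'S_n) (x : 'rV[R]_n), A x -> f (col_perm s x) = f x.

Definition concave_on (R : realType) (n : nat) (A : set 'rV[R]_n)
    (f : 'rV[R]_n -> R) : Prop :=
  convex_function A (fun x => - f x).

(* lim_{t -> +oo} f (t x) > f y for all x, y in A; the limit is taken in the
   extended reals, +oo being allowed. *)
Definition ray_limit_gt (R : realType) (n : nat) (A : set 'rV[R]_n)
    (f : 'rV[R]_n -> R) : Prop :=
  forall x y : 'rV[R]_n, A x -> A y ->
    exists2 l : \bar R,
      (f (t *: x))%:E @[t --> +oo] --> l & ((f y)%:E < l)%E.

Definition lambda_of (R : realType) (n : nat) (r : R) (mu : 'rV[R]_n) :
    'rV[R]_n :=
  \row_(i < n) (r^-1 * (\sum_(j < n) mu 0 j - (n%:R - r) * mu 0 i)).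

Definition mu_of (R : realType) (n : nat) (r : R) (lam : 'rV[R]_n) :
    'rV[R]_n :=
  \row_(i < n) ((n%:R - r)^-1 * (\sum_(j < n) lam 0 j - r * lam 0 i)).

Definition cone_tilde (R : realType) (n : nat) (r : R) (G : set 'rV[R]_n) :
    set 'rV[R]_n :=
  lambda_of r @` G.

Definition fun_tilde (R : realType) (n : nat) (r : R) (f : 'rV[R]_n -> R) :
    'rV[R]_n -> R :=
  fun lam => f (mu_of r lam).

(* ['D_v g x] has an arbitrary value when the directional derivative does not
   exist, so existence of the partial derivatives is stated explicitly. *)
Definition uniformly_elliptic_on (R : realType) (n : nat) (A : set 'rV[R]_n)
    (g : 'rV[R]_n -> R) : Prop :=
  exists2 theta : R, 0 < theta &
    forall (lam : 'rV[R]_n) (i : 'I_n), A lam ->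
      [/\ derivable g lam (delta_mx 0 i),
          theta * (\sum_(j < n) partial j g lam) <= partial i g lam &
          0 < theta * (\sum_(j < n) partial j g lam)].

(* Main.v *)
(** Write [L] for the differential of [f] at [mu].  Concavity together with the
    growth of [f] along rays gives [L > 0] on [G], hence [L >= 0] on the closure
    of [G].  With [a_i] the partial derivatives of [f] at [mu] and
    [r = varrho G], evaluating [L] at the permutations of [(1, ..., 1, 1 - r)]
    gives [r * a_i <= \sum_j a_j].  The derivatives of the transformed function
    are [(\sum_j a_j - rho * a_i) / (n - rho)], with sum [\sum_j a_j], and
    [0 <= a_i <= (\sum_j a_j) / r] bounds them below by a fixed fraction of
    that sum as soon as [rho < r]. *)
Require Import Defs.
From mathcomp Require Import all_boot all_order all_algebra all_fingroup.
From mathcomp Require Import all_classical all_reals all_analysis.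
From mathcomp Require Import ring lra.

Set Implicit Arguments.
Unset Strict Implicit.

Import Order.TTheory GRing.Theory Num.Theory.
Import numFieldNormedType.Exports.

Local Open Scope classical_set_scope.
Local Open Scope ring_scope.

(** * Linear functionals positive on a cone, and the boundary parameter *)

Section PositiveWeights.
Context {R : realType} {n : nat}.
Implicit Types (G : set 'rV[R]_n) (a : 'I_n -> R).

(** The functional is kept as its family of coefficients, so that permutations act on it by
    composition. *)
Definition positive_weights G a :=
  forall x, G x -> 0 < \sum_i x 0 i * a i.

Lemma positive_weights_closure G a x :
  positive_weights G a -> closure G x -> 0 <= \sum_i x 0 i * a i.
Proof.
move=> Ga Gx.
have ca : continuous (fun x : 'rV[R]_n => \sum_i x 0 i * a i).
  apply: continuous_big => [|i _ y].
    by move=> y; exact: add_continuous.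
  apply: (@continuousM _ _ (fun x : 'rV[R]_n => x 0 i) (cst (a i))).
    exact: coord_continuous.
  exact: cst_continuous.
have : closed [set x : 'rV[R]_n | 0 <= \sum_i x 0 i * a i].
  by apply: preimage_closed (@closed_ge _ 0) => y _; exact: ca.
rewrite closure_id => E.
suff : [set x : 'rV[R]_n | 0 <= \sum_i x 0 i * a i] x by [].
by rewrite E; apply: closureS Gx => y /Ga /ltW.
Qed.

Lemma positive_weights_perm G a (s : 'S_n) : is_cone G ->
  positive_weights G a -> positive_weights G (a \o s).
Proof.
move=> cG Ga x Gx; have := Ga _ (cone_sym cG (s^-1)%g Gx).
rewrite (reindex_inj (@perm_inj _ s)) /=; congr (_ < _).
by apply: eq_bigr => i _; rewrite mxE permK.
Qed.

Lemma pairing_last_shift a (r : R) (l : 'I_n) : l.+1 = n ->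
  \sum_i last_shift n r 0 i * a i = \sum_i a i - r * a l.
Proof.
move=> ln; rewrite (bigD1 l) //= [in RHS](bigD1 l) //= mxE ifT; last exact/eqP.
rewrite (eq_bigr a) ?mulrBl ?mul1r 1?addrAC // => i il.
rewrite mxE ifN ?mul1r //; apply: contraNN il => /eqP il.
by apply/eqP/val_inj/succn_inj; rewrite /= il ln.
Qed.

Lemma positive_weights_sum_gt0 G a : is_cone G ->
  positive_weights G a -> 0 < \sum_i a i.
Proof.
move=> cG /(_ (const_mx 1)).
have /(cone_orthant cG) h : positive_orthant (const_mx 1 : 'rV[R]_n).
  by move=> i; rewrite mxE.
move=> /(_ h); congr (_ < _); apply: eq_bigr => i _.
by rewrite mxE mul1r.
Qed.

Lemma positive_weights_ge0 G a i : is_cone G ->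
  positive_weights G a -> 0 <= a i.
Proof.
move=> cG Ga; have S0 := positive_weights_sum_gt0 cG Ga.
rewrite leNgt; apply/negP => ai0.
(* With this [e] the pairing of [a] with the positive vector e_i + e (1, ..., 1) is a_i + e \sum_j
   a_j = 0, contradicting positivity. *)
pose e : R := - a i / \sum_j a j.
have e0 : 0 < e by rewrite divr_gt0 ?oppr_gt0.
have /(cone_orthant cG)/Ga : positive_orthant (\row_j ((j == i)%:R + e)).
  by move=> j; rewrite mxE ltr_wpDl.
under eq_bigr do rewrite mxE mulrDl.
rewrite big_split /= -mulr_sumr divfK ?gt_eqF // (bigD1 i) //= eqxx mul1r.
by rewrite big1 ?addr0 ?subrr ?ltxx // => j /negbTE ->; rewrite mul0r.
Qed.

(** Symmetry of [G] allows exchanging [a i] with the last weight, which is the one paired with 1 -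
    r; the total of the weights does not change. *)
Lemma positive_weights_boundary G a r i : is_cone G ->
  positive_weights G a -> closure G (last_shift n r) ->
  r * a i <= \sum_j a j.
Proof.
move=> cG Ga Gr; have n0 : (0 < n)%N by apply: leq_ltn_trans (ltn_ord i).
pose l : 'I_n := Ordinal (eq_leq (prednK n0)).
have ln : l.+1 = n by rewrite /= prednK.
have := positive_weights_closure (positive_weights_perm (tperm l i) cG Ga) Gr.
rewrite (pairing_last_shift _ _ ln) /= tpermL subr_ge0.
by rewrite [X in _ -> _ <= X](reindex_inj (@perm_inj _ (tperm l i))).
Qed.

(** Sum r a_i <= \sum_j a_j over all i and divide by the positive total. *)
Lemma positive_weights_boundary_le G a r : is_cone G ->
  positive_weights G a -> closure G (last_shift n r) -> r <= n%:R.
Proof.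
move=> cG Ga Gr; have S0 := positive_weights_sum_gt0 cG Ga.
rewrite -(ler_pM2r S0) mulr_sumr.
rewrite [leRHS](_ : _ = \sum_(i < n) \sum_j a j); last first.
  by rewrite sumr_const card_ord mulr_natl.
by apply: ler_sum => i _; exact: positive_weights_boundary cG Ga Gr.
Qed.

(** For r <= 0 the point lies in the positive orthant, hence in the open set [G], which contains no
    point of its boundary. *)
Lemma boundary_last_shift_gt0 G r : is_cone G ->
  boundary G (last_shift n r) -> 0 < r.
Proof.
move=> cG [_ nG]; rewrite ltNge; apply/negP => r0; apply: nG.
rewrite ((interior_id G).1 (cone_open cG)); apply: (cone_orthant cG) => i.
by rewrite mxE; case: ifP => _ //; rewrite subr_gt0 (le_lt_trans r0).
Qed.

Lemma last_shift_continuous : continuous (fun r : R => last_shift n r).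
Proof.
pose u : 'rV[R]_n := \row_(i < n) (i.+1 == n)%:R.
have -> : (fun r : R => last_shift n r) = (fun r => const_mx 1 - r *: u).
  apply/funext => r; apply/rowP => i; rewrite !mxE.
  by case: eqP => _; rewrite ?mulr1 // mulr0 subr0.
move=> r; apply: cvgB; first exact: cvg_cst.
by apply: cvgZr_tmp; exact: cvg_id.
Qed.

(* If the line never met the boundary, its trace on [G] would be clopen, hence
   all of [R], against the bound of [positive_weights_boundary_le]. *)
Lemma boundary_last_shift_exists G a : is_cone G ->
  positive_weights G a -> exists r, boundary G (last_shift n r).
Proof.
move=> cG Ga; apply: contrapT => /forallNP nb.
pose S : set R := [set r | G (last_shift n r)].
have ScG : S = [set r | closure G (last_shift n r)].
  apply/seteqP; split=> r; first exact: (@subset_closure _ G).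
  move=> cr; apply: contrapT => nr; apply: (nb r); split=> //.
  by rewrite ((interior_id G).1 (cone_open cG)).
have connR : connected [set: R] by apply/connected_intervalP.
have : S = setT.
  apply: connR.
  - exists 0; apply: (cone_orthant cG) => i.
    by rewrite mxE subr0 if_same.
  - exists S; rewrite ?setTI //.
    by apply: open_comp (cone_open cG) => r _; exact: last_shift_continuous.
  - exists S; rewrite ?setTI // ScG.
    apply: preimage_closed (@closed_closure _ G) => r _.
    exact: last_shift_continuous.
move=> ST; have : S (n%:R + 1) by rewrite ST.
rewrite ScG => /(positive_weights_boundary_le cG Ga).
by rewrite gerDl ler10.
Qed.

(** Since [varrho] is chosen by [get], it has its defining property only once some boundary
    parameter is known to exist. *)
Lemma varrho_boundary G a : is_cone G ->
  positive_weights G a -> boundary G (last_shift n (varrho G)).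
Proof.
move=> cG /(boundary_last_shift_exists cG).
exact: (@getPex _ [set r | boundary G (last_shift n r)]).
Qed.

End PositiveWeights.

(** * The gradient of f and the linear change of variables *)

Section Gradient.
Context {R : realType} {n : nat}.
Implicit Types (G : set 'rV[R]_n) (f : 'rV[R]_n -> R).

(** By concavity, the difference quotients at [x] towards [y] are at least f y - f x for 0 < t <= 1;
    let t tend to 0 from the right. *)
Lemma concave_gradient_ineq G f x y : concave_on G f -> G x -> G y ->
  differentiable f x -> f y - f x <= 'd f x (y - x).
Proof.
move=> cf Gx Gy df; rewrite -deriveE //.
have /cvg_dnbhs_at_right h := @diff_derivable _ _ _ f x (y - x) df.
apply: (cvgr_to_ge h); near=> t.
have t0 : 0 < t by near: t; exact: nbhs_right_gt.
have t1 : t <= 1 by near: t; apply: nbhs_right_le.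
have ht : - f (t *: y + (1 - t) *: x) <= t * (- f y) + (1 - t) * (- f x).
  exact: (cf (Itv01 (ltW t0) t1) y x (mem_set Gy) (mem_set Gx)).
suff : f y - f x <= t^-1 * (f (t *: (y - x) + x) - f x) by [].
rewrite mulrC ler_pdivlMr //.
have -> : t *: (y - x) + x = t *: y + (1 - t) *: x.
  by rewrite scalerBr scalerBl scale1r -addrA [- _ + _]addrC.
lra.
Unshelve. all: by end_near. Qed.

Lemma ray_limit_gt_exists G f x y (M : R) : ray_limit_gt G f -> G x -> G y ->
  exists2 t, M < t & f y < f (t *: x).
Proof.
move=> fl Gx Gy; have [l fxl yl] := fl x y Gx Gy.
have /fxl fxy : nbhs l [set u | ((f y)%:E < u)%E].
  by apply: open_nbhs_nbhs; split=> //; exact: open_ereal_gt_ereal.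
have [t [Mt /=]] := filter_ex (filterI (nbhs_pinfty_gt (num_real M)) fxy).
by rewrite lte_fin; exists t.
Qed.

(** The gradient inequality is used twice. Some t > 1 with f (t x) > f x gives positivity in the
    radial direction [x]. Then some t > 0 with f (t y) > f x gives t df(y) > df(x) > 0. *)
Lemma gradient_gt0 G f x y : is_cone G -> concave_on G f ->
  ray_limit_gt G f -> G x -> G y -> differentiable f x -> 0 < 'd f x y.
Proof.
move=> cG cf fl Gx Gy df.
have xx0 : 0 < 'd f x x.
  have [t t1 ft] := ray_limit_gt_exists 1 fl Gx Gx.
  have Gtx : G (t *: x) by apply: cone_scale => //; exact: lt_trans t1.
  have := concave_gradient_ineq cf Gx Gtx df.
  have -> : t *: x - x = (t - 1) *: x by rewrite scalerBl scale1r.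
  rewrite linearZ /= => h.
  have {h} : 0 < (t - 1) * 'd f x x by apply: lt_le_trans h; rewrite subr_gt0.
  by rewrite pmulr_rgt0 // subr_gt0.
have [t t0 ft] := ray_limit_gt_exists 0 fl Gy Gx.
have := concave_gradient_ineq cf Gx (cone_scale cG t0 Gy) df.
rewrite linearB linearZ /= => h.
have {h} : 0 < t * 'd f x y.
  have : 0 < f (t *: y) - f x by rewrite subr_gt0.
  by move=> h'; have := lt_le_trans h' h; rewrite subr_gt0; exact: lt_trans.
by rewrite pmulr_rgt0.
Qed.

Lemma diff_rowE f x v : 'd f x v = \sum_i v 0 i * 'd f x (delta_mx 0 i).
Proof.
rewrite {1}[v]row_sum_delta linear_sum; apply: eq_bigr => i _.
by rewrite linearZ.
Qed.

Lemma gradient_positive_weights G f x : is_cone G -> concave_on G f ->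
  ray_limit_gt G f -> G x -> differentiable f x ->
  positive_weights G (fun i => 'd f x (delta_mx 0 i)).
Proof.
move=> cG cf fl Gx df y Gy; rewrite -diff_rowE.
exact: gradient_gt0 cG cf fl Gx Gy df.
Qed.

Lemma mu_of_is_linear (rho : R) : linear (@mu_of R n rho).
Proof.
move=> c u v; apply/rowP => i; rewrite !mxE.
under eq_bigr do rewrite !mxE.
by rewrite big_split /= -mulr_sumr; ring.
Qed.

(** [lambda_of] preserves the sum of the coordinates, as (n - (n - rho)) / rho = 1; each mu_i can
    then be solved for. *)
Lemma lambda_ofK (rho : R) : rho != 0 -> rho != n%:R ->
  cancel (@lambda_of R n rho) (mu_of rho).
Proof.
move=> r0 rn mu; apply/rowP => i; rewrite !mxE.
under eq_bigr do rewrite !mxE.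
rewrite -mulr_sumr sumrB -mulr_sumr sumr_const card_ord -mulr_natl.
field.
by rewrite r0 subr_eq0 eq_sym rn.
Qed.

(** Linearity of [mu_of] makes the difference quotients of both functions literally equal. *)
Lemma derive_fun_tilde f (rho : R) x v :
  differentiable f (mu_of rho x) ->
  derivable (fun_tilde rho f) x v /\
  'D_v (fun_tilde rho f) x = 'd f (mu_of rho x) (mu_of rho v).
Proof.
move=> df; have E : (fun h : R => h^-1 *:
    ((fun_tilde rho f \o shift x) (h *: v) - fun_tilde rho f x)) =
    (fun h => h^-1 *:
    ((f \o shift (mu_of rho x)) (h *: mu_of rho v) - f (mu_of rho x))).
  by apply/funext => h /=; rewrite /fun_tilde mu_of_is_linear.
rewrite -deriveE // /derivable /derive E; split=> //.
exact: diff_derivable.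
Qed.

(** Coordinate j of the image of e_i is 1 / (n - rho), with 1 replaced by 1 - rho when j = i. *)
Lemma diff_mu_of_delta f (rho : R) x i :
  'd f x (mu_of rho (delta_mx 0 i)) =
  (n%:R - rho)^-1 * (\sum_j 'd f x (delta_mx 0 j) - rho * 'd f x (delta_mx 0 i)).
Proof.
rewrite diff_rowE (eq_bigr (fun j => (n%:R - rho)^-1 *
  ('d f x (delta_mx 0 j) - (j == i)%:R * (rho * 'd f x (delta_mx 0 i))))).
  rewrite -mulr_sumr sumrB; congr (_ * (_ - _)).
  rewrite (bigD1 i) //= eqxx mul1r big1 ?addr0 // => j /negbTE ->.
  by rewrite mul0r.
move=> j _; rewrite mxE (bigD1 i) //= !mxE !eqxx big1 ?addr0.
  by case: eqVneq => [->|_]; rewrite /= ?mulr1 ?mulr0; ring.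
by move=> k /negbTE ki; rewrite mxE ki andbF.
Qed.

End Gradient.

Unset Implicit Arguments.
Set Strict Implicit.

Theorem proposition3p1 (R : realType) (n : nat) (hn : (2 <= n)%N)
    (G : set 'rV[R]_n) (hG : is_cone G)
    (f : 'rV[R]_n -> R)
    (f_smooth : smooth_on G f)
    (f_sym : symmetric_on G f)
    (f_concave : concave_on G f)
    (f_lim : ray_limit_gt G f)
    (rho : R) (rho_lt : rho < varrho G) (rho_neq0 : rho <> 0) :
  uniformly_elliptic_on (cone_tilde rho G) (fun_tilde rho f).
Proof.
have df x : G x -> differentiable f x by exact: (f_smooth [::]).
have wpos x (Gx : G x) :=
  gradient_positive_weights hG f_concave f_lim Gx (df x Gx).
(* The gradient at this one point supplies the weights for the facts about [varrho G], which concern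
   [G] alone. *)
have G1 : G (const_mx 1) by apply: (cone_orthant hG) => i; rewrite mxE.
have bG := varrho_boundary hG (wpos _ G1).
have r0 := boundary_last_shift_gt0 hG bG.
have rn := positive_weights_boundary_le hG (wpos _ G1) bG.1.
set r := varrho G in rho_lt bG r0 rn *.
have nrho : 0 < n%:R - rho by rewrite subr_gt0 (lt_le_trans rho_lt).
(* The entry 1 serves rho <= 0, where - rho a_i >= 0; the entry 1 - rho / r serves rho > 0, where
   a_i <= (\sum_j a_j) / r. *)
have c0 : 0 < Num.min 1 (1 - rho / r).
  by rewrite lt_min ltr01 subr_gt0 ltr_pdivrMr ?mul1r.
exists ((n%:R - rho)^-1 * Num.min 1 (1 - rho / r)).
  by rewrite mulr_gt0 ?invr_gt0.
move=> _ i [mu Gmu <-]; set lam := lambda_of rho mu.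
have mulam : mu_of rho lam = mu.
  by rewrite lambda_ofK; [| exact/eqP | rewrite -subr_eq0 -oppr_eq0 opprB gt_eqF].
pose a j := 'd f mu (delta_mx 0 j).
have dft : differentiable f (mu_of rho lam) by rewrite mulam; exact: df.
have partialE j : partial j (fun_tilde rho f) lam =
    (n%:R - rho)^-1 * (\sum_k a k - rho * a j).
  by rewrite /partial (derive_fun_tilde _ dft).2 mulam diff_mu_of_delta.
have S0 : 0 < \sum_j a j := positive_weights_sum_gt0 hG (wpos _ Gmu).
have a0 : 0 <= a i := positive_weights_ge0 i hG (wpos _ Gmu).
have ar : r * a i <= \sum_j a j := positive_weights_boundary i hG (wpos _ Gmu) bG.1.
(* Summing over j yields (n - rho) \sum_k a_k, which cancels the prefactor. *)
have -> : \sum_(j < n) partial j (fun_tilde rho f) lam = \sum_j a j.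
  under eq_bigr do rewrite partialE.
  rewrite -mulr_sumr sumrB sumr_const card_ord -mulr_sumr.
  rewrite -[(\sum_k a k) *+ n]mulr_natl -mulrBl.
  by rewrite mulKf // gt_eqF.
split; first exact: (derive_fun_tilde _ dft).1.
- rewrite partialE -mulrA ler_pM2l ?invr_gt0 //.
  have [rho0|rho0] := leP rho 0.
    apply: (@le_trans _ _ (\sum_j a j)).
      by rewrite ler_piMl ?ge_min ?lexx // ltW.
    by rewrite lerDl oppr_ge0 mulr_le0_ge0.
  apply: (@le_trans _ _ ((1 - rho / r) * \sum_j a j)).
    by rewrite ler_pM2r // ge_min lexx orbT.
  rewrite mulrBl mul1r lerD2l lerN2 -mulrA ler_pM2l //.
  by rewrite -ler_pdivrMl ?invr_gt0 // invrK.
- by rewrite !mulr_gt0 ?invr_gt0.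
Qed.
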